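(* Let $\mathcal{H}$ be a real separable Hilbert space and let $\{e_n : n\in\mathbb{N}\}$ and $\{d_n : n\in\mathbb{N}\}$ be orthonormal bases of $\mathcal{H}$. Then the following are equivalent: (i) The system $\{\tfrac{1}{\sqrt2}(e_n+id_n) : n\in\mathbb{N}\}$ is an orthonormal basis of the complex Hilbert space $\mathcal{H}+i\mathcal{H}$. (ii) For all $n,k\in\mathbb{N}$, $\langle d_n,e_k\rangle=\langle d_k,e_n\rangle$.
   Context: $\mathcal{H}+i\mathcal{H}$ is the complexification of the real Hilbert space $\mathcal{H}$: the complex Hilbert space of all $f_r+if_i$ with $f_r,f_i\in\mathcal{H}$ and inner product $\langle f_r+if_i,g_r+ig_i\rangle=\langle f_r,g_r\rangle_{\mathcal{H}}+\langle f_i,g_i\rangle_{\mathcal{H}}+i(\langle f_i,g_r\rangle_{\mathcal{H}}-\langle f_r,g_i\rangle_{\mathcal{H}})$. *)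

(* Defs.v *)
From HB Require Import structures.
From mathcomp Require Import all_boot all_order all_algebra.
From mathcomp Require Import all_classical all_reals all_analysis.
From mathcomp Require Export complex.
From mathcomp Require Import ring lra.

Set Implicit Arguments.
Unset Strict Implicit.
Unset Printing Implicit Defensive.

Import Order.TTheory GRing.Theory Num.Theory.
Import numFieldNormedType.Exports.

Local Open Scope classical_set_scope.
Local Open Scope ring_scope.
Local Open Scope complex_scope.

(* A Hilbert space over K is a complete normed module whose norm comes from a
   positive definite form, linear in its first argument and theta-linear in
   its second; theta is the conjugation of K, namely idfun for a real field
   and Num.conj for a complex one. *)
HB.mixin Record CompleteNormedModule_isHilbert (K : numFieldType)
    (theta : K -> K) H & CompleteNormedModule K H := {
  inner : {dot H for theta};
  sqr_norm_inner : forall x : H, `|x| ^+ 2 = inner x x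
}.

#[short(type="hilbertType")]
HB.structure Definition Hilbert (K : numFieldType) (theta : K -> K) :=
  {H of CompleteNormedModule_isHilbert K theta H & CompleteNormedModule K H}.

Arguments inner {K theta s}.


Definition separable (T : topologicalType) :=
  exists2 A : set T, countable A & dense A.

Section orthonormal_basis.
Context {K : numFieldType} {theta : K -> K} {H : hilbertType theta}.
Implicit Type e : nat -> H.

Definition orthonormal_system e := forall m n, inner (e m) (e n) = (m == n)%:R.

Definition linear_span e : set H :=
  [set x | exists n (c : nat -> K), x = \sum_(i < n) c i *: e i].

Definition orthonormal_basis e :=
  orthonormal_system e /\ dense (linear_span e).

End orthonormal_basis.

(* [Complexified x y] stands for x + i y. *)
Record complexification (H : Type) := Complexified { rpart : H ; ipart : H }.

Section complexification_algebra.
Context {R : realType} {H : hilbertType (@idfun R)}.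
Local Notation HC := (complexification H).
Implicit Types (f g : HC) (z : R[i]).

Lemma complexification_pairK :
  cancel (fun f => (rpart f, ipart f)) (fun p : H * H => Complexified p.1 p.2).
Proof. by case. Qed.

HB.instance Definition _ := Choice.copy HC (can_type complexification_pairK).

Definition addcx f g := Complexified (rpart f + rpart g) (ipart f + ipart g).
Definition oppcx f := Complexified (- rpart f) (- ipart f).
Definition scalecx z f :=
  Complexified (complex.Re z *: rpart f - complex.Im z *: ipart f)
               (complex.Re z *: ipart f + complex.Im z *: rpart f).

Fact addcxA : associative addcx.
Proof. by move=> [a b] [c d] [g h]; rewrite /addcx/= !addrA. Qed.
Fact addcxC : commutative addcx.
Proof. by move=> [a b] [c d]; rewrite /addcx/= addrC [b + d]addrC. Qed.
Fact add0cx : left_id (Complexified 0 0) addcx.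
Proof. by move=> [a b]; rewrite /addcx/= !add0r. Qed.
Fact addNcx : left_inverse (Complexified 0 0) oppcx addcx.
Proof. by move=> [a b]; rewrite /addcx/= !addNr. Qed.

HB.instance Definition _ :=
  GRing.isZmodule.Build HC addcxA addcxC add0cx addNcx.

Fact scalecxA z w f : scalecx z (scalecx w f) = scalecx (z * w) f.
Proof.
case: z w f => [a b] [c d] [x y]; rewrite /scalecx/=.
rewrite !(scalerDr, scalerBr, scalerDl, scalerBl, scaleNr, scalerN, scalerA).
by congr Complexified; rewrite ?opprD (AC (2*2) ((1*4)*(2*3))).
Qed.
Fact scale1cx : left_id 1 scalecx.
Proof. by move=> [x y]; rewrite /scalecx/= !scale1r !scale0r subr0 addr0. Qed.
Fact scalecxDr : right_distributive scalecx +%R.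
Proof.
move=> [a b] [x y] [z t]; rewrite /scalecx/= !scalerDr.
by congr Complexified; rewrite ?opprD addrACA.
Qed.
Fact scalecxDl f : {morph scalecx^~ f : z w / z + w}.
Proof.
move: f => [x y] [a b] [c d]; rewrite /scalecx/= !scalerDl.
by congr Complexified; rewrite ?opprD addrACA.
Qed.

HB.instance Definition _ :=
  GRing.Zmodule_isLmodule.Build R[i] HC scalecxA scale1cx scalecxDr scalecxDl.

Definition innercx f g : R[i] :=
  (inner (rpart f) (rpart g) + inner (ipart f) (ipart g))
  +i* (inner (ipart f) (rpart g) - inner (rpart f) (ipart g)).

Definition normcx f : R[i] := (Num.sqrt (`|rpart f| ^+ 2 + `|ipart f| ^+ 2))%:C.

Lemma innerrDl (x y z : H) : inner (x + y) z = inner x z + inner y z.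
Proof. exact: linearDl. Qed.
Lemma innerrDr (x y z : H) : inner z (x + y) = inner z x + inner z y.
Proof. exact: linearDr. Qed.
Lemma innerrNl (x z : H) : inner (- x) z = - inner x z.
Proof. exact: linearNl. Qed.
Lemma innerrNr (x z : H) : inner z (- x) = - inner z x.
Proof. exact: linearNr. Qed.
Lemma innerrZl (a : R) (x z : H) : inner (a *: x) z = a * inner x z.
Proof. exact: linearZl_LR. Qed.
Lemma innerrZr (a : R) (x z : H) : inner z (a *: x) = a * inner z x.
Proof. exact: linearZr. Qed.
Lemma innerrC (x y : H) : inner x y = inner y x.
Proof. by rewrite (hermitian_subproof x y) expr0 mul1r. Qed.

Fact ler_normcxD f g : normcx (f + g) <= normcx f + normcx g.
Proof.
have E h : normcx h = `|(`|rpart h| +i* `|ipart h|)|.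
  by rewrite normc_def.
rewrite !E (le_trans _ (ler_normD _ _))// !normc_def/= lecR ler_sqrt.
  by rewrite lerD// lerXn2r ?nnegrE ?addr_ge0// ler_normD.
by rewrite addr_ge0// sqr_ge0.
Qed.

Fact normcxZ z f : normcx (z *: f) = `|z| * normcx f.
Proof.
case: z f => [a b] [x y]; rewrite normc_def /normcx/= -rmorphM/=.
rewrite -sqrtrM ?addr_ge0 ?sqr_ge0//; congr (Num.sqrt _)%:C.
rewrite !sqr_norm_inner !(innerrDl, innerrDr, innerrNl, innerrNr).
rewrite !(innerrZl, innerrZr) (innerrC y x); ring.
Qed.

Fact normcx_eq0 f : normcx f = 0 -> f = 0.
Proof.
move=> /complexI/eqP; rewrite sqrtr_eq0 => q0.
have /eqP : `|rpart f| ^+ 2 + `|ipart f| ^+ 2 = 0.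
  by apply/eqP; rewrite eq_le q0 addr_ge0// sqr_ge0.
rewrite paddr_eq0 ?sqr_ge0// !sqrf_eq0 !normr_eq0.
by case: f {q0} => [x y]/= /andP[/eqP-> /eqP->].
Qed.

HB.instance Definition _ :=
  Lmodule_isNormed.Build R[i] HC ler_normcxD normcxZ normcx_eq0.

Lemma le_rpart f : `|rpart f|%:C <= `|f|.
Proof. by rewrite lecR -[leLHS]normr_id -sqrtr_sqr ler_wsqrtr// lerDl sqr_ge0. Qed.

Lemma le_ipart f : `|ipart f|%:C <= `|f|.
Proof. by rewrite lecR -[leLHS]normr_id -sqrtr_sqr ler_wsqrtr// lerDr sqr_ge0. Qed.

Lemma normcx_le f : `|f| <= (`|rpart f| + `|ipart f|)%:C.
Proof.
rewrite lecR -[leRHS]ger0_norm ?addr_ge0// -sqrtr_sqr ler_wsqrtr//.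
by rewrite sqrrD -addrA lerD2l lerDr mulrn_wge0// mulr_ge0.
Qed.

Fact cvgcx (F : set_system HC) : ProperFilter F -> cauchy F -> cvg F.
Proof.
move=> FF /cauchy_ballP cF.
have part_cvg (p : HC -> H) : {morph p : f g / f - g} ->
    (forall f, `|p f|%:C <= `|f|) -> cvg (p @ F).
  move=> pB ple; apply/cauchy_cvgP/cauchy_ballP => e e0; rewrite near_map2.
  have := cF e%:C; rewrite ltcR => /(_ e0).
  apply: filterS => -[f g]; rewrite -!ball_normE/= => fg.
  by rewrite -ltcR -pB (le_lt_trans (ple _)).
have /cvg_ex[x Fx] := part_cvg (@rpart H) (fun _ _ => erefl) le_rpart.
have /cvg_ex[y Fy] := part_cvg (@ipart H) (fun _ _ => erefl) le_ipart.
apply/cvg_ex; exists (Complexified x y).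
apply/cvgrPdist_lt => e e0.
have eE : e = (complex.Re e)%:C by rewrite RRe_real// gtr0_real.
have e20 : 0 < complex.Re e / 2 by rewrite divr_gt0// -ltcR -eE.
move/cvgrPdist_lt/(_ _ e20) : Fx; rewrite near_map => Fx.
move/cvgrPdist_lt/(_ _ e20) : Fy; rewrite near_map => Fy.
near=> f; apply: (le_lt_trans (normcx_le _)).
by rewrite eE ltcR [ltRHS]splitr ltrD//=; near: f.
Unshelve. all: by end_near. Qed.

HB.instance Definition _ := Uniform_isComplete.Build HC cvgcx.

Fact innercxDl h : {morph innercx^~ h : f g / f + g}.
Proof.
move: h => [u v] [x y] [z t]; rewrite /innercx/= !innerrDl.
by congr Complex; lra.
Qed.

Fact innercxZl z f g : innercx (z *: f) g = z * innercx f g.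
Proof.
case: z f g => [a b] [x y] [u v]; rewrite /innercx/=.
rewrite !(innerrDl, innerrNl, innerrZl).
by congr Complex; ring.
Qed.

Fact innercxC f g : innercx f g = (-1) ^+ false * Num.conj (innercx g f).
Proof.
case: f g => [x y] [u v]; rewrite expr0 mul1r /innercx/=.
rewrite (innerrC x u) (innerrC y v) (innerrC y u) (innerrC x v).
by congr Complex; rewrite opprB.
Qed.

Fact innercx_bilinear :
  bilinear_for ( *%R) (Num.conj \; *%R : GRing.Scale.law R[i] R[i]) innercx.
Proof.
split=> h z f g; first by rewrite innercxDl innercxZl.
rewrite [LHS]innercxC innercxDl innercxZl.
rewrite [innercx h f]innercxC [innercx h g]innercxC.
by rewrite !expr0 !mul1r rmorphD rmorphM.
Qed.

Fact sqr_normcx f : `|f| ^+ 2 = innercx f f.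
Proof.
rewrite -[LHS]rmorphXn/= sqr_sqrtr ?addr_ge0 ?sqr_ge0// !sqr_norm_inner.
by rewrite /innercx innerrC subrr.
Qed.

Fact innercx_gt0 f : f != 0 -> 0 < innercx f f.
Proof. by move=> f0; rewrite -sqr_normcx exprn_gt0// normr_gt0. Qed.

HB.instance Definition _ :=
  bilinear_isBilinear.Build R[i] HC HC R[i] _ _ innercx innercx_bilinear.
HB.instance Definition _ :=
  isHermitianSesquilinear.Build R[i] HC false Num.conj innercx innercxC.
HB.instance Definition _ := isDotProduct.Build R[i] HC innercx innercx_gt0.

HB.instance Definition _ :=
  CompleteNormedModule_isHilbert.Build R[i] Num.conj HC sqr_normcx.

End complexification_algebra.

(* Main.v *)
(* Write f_n = (e_n + i d_n)/sqrt 2.  Since <f_n, f_k> = delta_nk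
   + (i/2)(<d_n, e_k> - <e_n, d_k>), orthonormality of f is exactly the symmetry
   condition (ii).  Conversely, under (ii) the coefficients <d_k, e_n> of d_k in
   the basis e are also the coefficients <e_k, d_n> of e_k in the basis d, so
   sum_n <d_k, e_n> (e_n + i d_n) = d_k + i e_k lies in the closed span of f.
   Hence so does e_k = ((e_k + i d_k) - i (d_k + i e_k))/2, and then everything. *)
Require Import Defs.
From mathcomp Require Import all_boot all_order all_algebra.
From mathcomp Require Import all_classical all_reals all_analysis.
From mathcomp Require Import lra.

Set Implicit Arguments.
Unset Strict Implicit.
Unset Printing Implicit Defensive.

Import Order.TTheory GRing.Theory Num.Theory.
Import numFieldNormedType.Exports.

Local Open Scope classical_set_scope.
Local Open Scope ring_scope.
Local Open Scope complex_scope.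

Lemma denseP (T : topologicalType) (S : set T) :
  dense S <-> forall x, closure S x.
Proof.
split=> [dS x B Bx | clS U [x Ux] oU].
  have [y [By Sy]] : (B° `&` S) !=set0.
    by apply: dS; [exists x | exact: open_interior].
  by exists y; split=> //; exact: interior_subset.
have [y [Sy Uy]] := clS x U (open_nbhs_nbhs (conj oU Ux)).
by exists y.
Qed.

(** The preimage of [B] under [f] is closed, so it contains [closure A] once it contains [A]. Later
    arguments use this to pass from a span to its closure. *)
Lemma closure_image_sub (T U : topologicalType) (f : T -> U)
    (A : set T) (B : set U) : continuous f -> closed B ->
  (forall x, A x -> B (f x)) -> forall x, closure A x -> B (f x).
Proof.
move=> cf cB AB x /(closure_subset (AB : A `<=` f @^-1` B)).
by have /closure_id <- : closed (f @^-1` B)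
  by apply: closed_comp => // y _; exact: cf.
Qed.

Section span.
Context {K : numFieldType} {theta : K -> K} {H : hilbertType theta}.
Variable e : nat -> H.

(** Elements of [linear_span] are combinations over initial segments; padding with zero coefficients
    brings two of them to a common length. *)
Lemma linear_span_widen n m (c : nat -> K) : (n <= m)%N ->
  \sum_(i < n) c i *: e i =
  \sum_(i < m) (if (i < n)%N then c i else 0) *: e i.
Proof.
move=> nm; rewrite (big_ord_widen m (fun i => c i *: e i))// big_mkcond/=.
by apply: eq_bigr => i _; case: ifP => //; rewrite scale0r.
Qed.

Lemma linear_spanD x y :
  linear_span e x -> linear_span e y -> linear_span e (x + y).
Proof.
move=> [n [a ->]] [m [b ->]].
rewrite (linear_span_widen _ (leq_maxl n m)) (linear_span_widen _ (leq_maxr n m)).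
rewrite -big_split/=; exists (maxn n m), (fun i =>
  (if (i < n)%N then a i else 0) + (if (i < m)%N then b i else 0)).
by apply: eq_bigr => i _; rewrite scalerDl.
Qed.

Lemma linear_spanZ k x : linear_span e x -> linear_span e (k *: x).
Proof.
move=> [n [c ->]]; exists n, (fun i => k * c i).
by rewrite scaler_sumr; apply: eq_bigr => i _; rewrite scalerA.
Qed.

(** The closure is reached in one variable at a time: first in [x] with [y] fixed in the closure,
    then in [y] with the left summand in the span. *)
Lemma closed_spanD x y : closure (linear_span e) x ->
  closure (linear_span e) y -> closure (linear_span e) (x + y).
Proof.
have cl : closed (closure (linear_span e)) by exact: closed_closure.
move=> clx cly.
apply: (closure_image_sub (f := fun u => u + y)) clx => // [u|u Su].
  by apply: cvgD; [exact: cvg_id | exact: cvg_cst].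
apply: (closure_image_sub (f := fun v => u + v)) cly => // [v|v Sv].
  by apply: cvgD; [exact: cvg_cst | exact: cvg_id].
by apply: subset_closure; exact: linear_spanD.
Qed.

Lemma closed_spanZ k x : closure (linear_span e) x ->
  closure (linear_span e) (k *: x).
Proof.
move=> clx; apply: (closure_image_sub (f := fun u => k *: u)) clx => [u||u Su].
- by apply: cvgZr; exact: cvg_id.
- exact: closed_closure.
- by apply: subset_closure; exact: linear_spanZ.
Qed.

Lemma closed_span_sum n (c : nat -> K) (f : nat -> H) :
  (forall i, closure (linear_span e) (f i)) ->
  closure (linear_span e) (\sum_(i < n) c i *: f i).
Proof.
move=> clf; elim/big_ind: _ => [|x y|i _].
- by apply: subset_closure; exists 0%N, (fun=> 0); rewrite big_ord0.
- exact: closed_spanD.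
- exact: closed_spanZ.
Qed.

End span.

Section fourier.
Context {R : realType} {H : hilbertType (@idfun R)}.
Implicit Types (e : nat -> H) (x : H).

Lemma inner_ortho_sum e n (c : nat -> R) (i : 'I_n) : orthonormal_system e ->
  inner (\sum_(j < n) c j *: e j) (e i) = c i.
Proof.
move=> oe; rewrite linear_sumlz (bigD1 i)//= innerrZl oe eqxx mulr1.
rewrite big1 ?addr0// => j ji.
by rewrite innerrZl oe (negbTE (ji : (j : nat) != i)) mulr0.
Qed.

(** Pythagoras: with [p] the Fourier sum and [y] the competitor, [x - p] is orthogonal to every
    [e i] with [i < n], hence to [p - y], so the squared norm of [x - y] exceeds that of [x - p] by
    that of [p - y]. *)
Lemma fourier_best_approx e x n (c : nat -> R) : orthonormal_system e ->
  `|x - \sum_(i < n) inner x (e i) *: e i| <= `|x - \sum_(i < n) c i *: e i|.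
Proof.
move=> oe; set p := \sum_(i < n) inner x (e i) *: e i.
set y := \sum_(i < n) c i *: e i.
have xp0 : inner (x - p) (p - y) = 0.
  rewrite -sumrB linear_sumr big1// => i _.
  rewrite -scalerBl [LHS]innerrZr innerrDl innerrNl.
  by rewrite /p (inner_ortho_sum (fun j => inner x (e j)))// subrr mulr0.
rewrite -(@ler_pXn2r _ 2)// ?nnegrE// -[x - y](subrKA p).
move: (x - p) (p - y) xp0 => u v uv0.
rewrite !sqr_norm_inner innerrDl !innerrDr (innerrC v u) uv0 addr0 add0r.
by rewrite lerDl -sqr_norm_inner sqr_ge0.
Qed.

(** Density yields one combination, of some length [m], within [eps] of [x]. Padded with zeros it
    competes with the Fourier sum of every length [n >= m], and best approximation carries the bound
    over. *)
Lemma fourier_cvg e x : orthonormal_basis e ->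
  (\sum_(i < n) inner x (e i) *: e i @[n --> \oo] --> x).
Proof.
move=> [oe /denseP/(_ x) clx].
apply/cvgrPdist_lt => eps eps0.
have [_ [[m [c ->]]]] := clx _ (nbhsx_ballx x eps eps0).
rewrite -ball_normE/= => xy.
near=> n; apply: le_lt_trans xy.
have mn : (m <= n)%N by near: n; exists m.
rewrite (linear_span_widen _ _ mn).
exact: (fourier_best_approx x n (fun i => if (i < m)%N then c i else 0) oe).
Unshelve. all: by end_near. Qed.

End fourier.

Section complexification.
Context {R : realType} {H : hilbertType (@idfun R)}.
Local Notation HC := (complexification H).

Lemma cvg_Complexified (T : Type) (F : set_system T) {FF : Filter F}
    (f g : T -> H) (x y : H) : (f t @[t --> F] --> x) ->
  (g t @[t --> F] --> y) ->
  ((Complexified (f t) (g t) : HC) @[t --> F] --> (Complexified x y : HC)).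
Proof.
move=> fx gy; apply/cvgrPdist_lt => e e0.
(* A positive element of [R[i]] is real, so [e] can be halved and compared in [R]. *)
have eE : e = (complex.Re e)%:C by rewrite RRe_real// gtr0_real.
have e20 : 0 < complex.Re e / 2 by rewrite divr_gt0// -ltcR -eE.
move/cvgrPdist_lt/(_ _ e20) : fx => fx.
move/cvgrPdist_lt/(_ _ e20) : gy => gy.
near=> t; apply: (le_lt_trans (normcx_le _)).
by rewrite eE ltcR [ltRHS]splitr ltrD//=; near: t.
Unshelve. all: by end_near. Qed.

(** Real scalars act on both parts separately, so two real combinations sharing their coefficients
    form one complex combination. *)
Lemma Complexified_sum n (c : nat -> R) (f g : nat -> H) :
  Complexified (\sum_(i < n) c i *: f i) (\sum_(i < n) c i *: g i) =
  \sum_(i < n) (c i)%:C *: (Complexified (f i) (g i) : HC).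
Proof.
elim: n => [|n IHn]; first by rewrite !big_ord0.
rewrite !big_ord_recr/= -IHn.
by congr Complexified; rewrite /= scale0r ?subr0 ?addr0.
Qed.

End complexification.

Theorem proposition2p13 (R : realType) (H : hilbertType (@idfun R))
    (sepH : separable H) (e d : nat -> H)
    (he : orthonormal_basis e) (hd : orthonormal_basis d) :
  orthonormal_basis (fun n : nat =>
    ((Num.sqrt 2)^-1)%:C *: Complexified (e n) (d n)
      : complexification H)
  <-> forall n k : nat, inner (d n) (e k) = inner (d k) (e n).
Proof.
set f := (X in orthonormal_basis X).
have [oe _] := he; have [od _] := hd.
have s0 : Num.sqrt 2 != 0 :> R by rewrite gt_eqF// sqrtr_gt0.
have s2 : (Num.sqrt 2)^-1 * (Num.sqrt 2)^-1 = 2^-1 :> R.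
  by rewrite -invfM -expr2 sqr_sqrtr.
have innerf n k : inner (f n) (f k) =
    (n == k)%:R +i* (2^-1 * (inner (d n) (e k) - inner (e n) (d k))).
  (* [inner] on the complexification is [innercx] by conversion, which exposes its real and
     imaginary parts. *)
  change (innercx (f n) (f k) =
    (n == k)%:R +i* (2^-1 * (inner (d n) (e k) - inner (e n) (d k)))).
  rewrite /innercx/= !scale0r !subr0 !addr0 !(innerrZl, innerrZr) oe od.
  rewrite !mulrA s2; congr Complex; first by lra.
  by rewrite -mulrBr.
split=> [[onf _] n k|sym].
  have := congr1 (@complex.Im R) (onf n k); rewrite innerf /=.
  have -> : complex.Im (n == k)%:R = 0 :> R by case: eqP.
  by move=> /eqP; rewrite mulf_eq0 invr_eq0 pnatr_eq0/= subr_eq0 (innerrC (e n)) => /eqP.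
split=> [n k|].
  rewrite innerf (innerrC (e n)) sym subrr mulr0.
  by case: eqP.
(* What remains is density: the closed subspace [C] must be shown to contain every vector. *)
pose C := closure (linear_span f).
have CD u v : C u -> C v -> C (u + v) by exact: closed_spanD.
have CZ z u : C u -> C (z *: u) by exact: closed_spanZ.
have clf n : C (f n).
  apply: subset_closure; exists n.+1, (fun i => (i == n)%:R).
  rewrite big_ord_recr/= eqxx scale1r big1 ?add0r// => i _.
  by rewrite ltn_eqF// scale0r.
have clg n : C (Complexified (e n) (d n)).
  have -> : Complexified (e n) (d n) = (Num.sqrt 2)%:C *: f n.
    by rewrite scalerA -rmorphM/= divff// scale1r.
  exact: CZ.
have clg' k : C (Complexified (d k) (e k)).
  (* Partial Fourier sums of [d k] along [e] and of [e k] along [d]; by [sym] their coefficients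
     agree, so each [g n] is a combination of the vectors [e i + i d i]. *)
  pose g n := Complexified (\sum_(i < n) inner (d k) (e i) *: e i)
                           (\sum_(i < n) inner (e k) (d i) *: d i).
  have Cg n : C (g n).
    have -> : g n = \sum_(i < n) (inner (d k) (e i))%:C *:
        (Complexified (e i) (d i) : complexification H).
      rewrite -(Complexified_sum n (fun i => inner (d k) (e i)) e d).
      congr Complexified; apply: eq_bigr => i _.
      by rewrite (innerrC (e k)) sym.
    exact: (closed_span_sum (c := fun i => (inner (d k) (e i))%:C) clg).
  apply: (@closed_cvg _ _ \oo _ g C) => //.
  - exact: closed_closure.
  - by apply: nearW => n; exact: Cg.
  - by apply: cvg_Complexified; exact: fourier_cvg.
have cle k : C (Complexified (e k) 0).
  have -> : Complexified (e k) 0 =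
      (2^-1)%:C *: ((Complexified (e k) (d k) : complexification H)
                    + (- 'i) *: (Complexified (d k) (e k) : complexification H)).
    congr Complexified; rewrite /= oppr0 !scale0r !scaleN1r ?sub0r ?add0r.
      rewrite subr0 opprK -mulr2n -[e k *+ 2]scaler_nat scalerA.
      by rewrite mulVf ?pnatr_eq0// scale1r.
    by rewrite subrr scaler0 addr0.
  by apply: (CZ); apply: (CD) => //; exact: CZ.
(* The embedding of [x] as [x + i 0] is continuous and sends real combinations of the [e k] into
   [C]; density of their span gives all of [H]. *)
have clr x : C (Complexified x 0).
  have /denseP/(_ x) clx := he.2.
  apply: (closure_image_sub (B := C)
    (f := fun u : H => Complexified u 0 : complexification H)) clx => [u||].
  - by apply: cvg_Complexified; [exact: cvg_id | exact: cvg_cst].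
  - exact: closed_closure.
  - move=> _ [n [c ->]] /=.
    have -> : Complexified (\sum_(i < n) c i *: e i) 0 =
        \sum_(i < n) (c i)%:C *: (Complexified (e i) 0 : complexification H).
      rewrite -(Complexified_sum n c e (fun=> 0)); congr Complexified.
      by rewrite big1// => i _; rewrite scaler0.
    exact: (closed_span_sum (c := fun i => (c i)%:C) cle).
apply/denseP => -[x y].
(* Multiplication by ['i] supplies the imaginary part from the real case. *)
have -> : Complexified x y = (Complexified x 0 : complexification H)
    + 'i *: (Complexified y 0 : complexification H).
  congr Complexified; rewrite /= !scale0r.
    by rewrite scaler0 subr0 addr0.
  by rewrite scale1r !add0r.
by apply: (CD) => //; exact: CZ.
Qed.
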